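(* ($H^1$–BMO type duality inequality.) Let $\mu=\mu_n\times\mu_m$, where $\mu_n,\mu_m$ are upper doubling measures on $\mathbb{R}^n,\mathbb{R}^m$. If $b\in\mathrm{BMO}_{\mathrm{prod}}(\mu)$, then for all dyadic grids $\mathcal D_n,\mathcal D_n'$ in $\mathbb{R}^n$ and $\mathcal D_m,\mathcal D_m'$ in $\mathbb{R}^m$, and for all functions $f$ of the form $$f=\sum_{\substack{\eta_1\neq0\\ \kappa_1\ne0}}\ \sum_{\substack{I_1\in\mathcal D_{n}\text{ good}\\ J_1\in\mathcal D_{m}\text{ good}}}\lambda_{I_1J_1}^{\eta_1\kappa_1}\,h_{I_1,\eta_1}\otimes u_{J_1,\kappa_1}$$ with scalar coefficients $\lambda_{I_1J_1}^{\eta_1\kappa_1}$, there holds $$|\langle b,f\rangle|\le C\,\|b\|_{\mathrm{BMO}_{\mathrm{prod}}(\mu)}\,\big\|S_{\mathcal D_n\mathcal D_m}^{\mathcal D_n'\mathcal D_m'}f\big\|_{L^1(\mu)},$$ where $$S_{\mathcal D_n\mathcal D_m}^{\mathcal D_n'\mathcal D_m'}f=\Big(\sum_{\substack{\eta_1\neq0\\ \kappa_1\ne0}}\ \sum_{\substack{I_1\in\mathcal D_{n}\text{ good}\\ J_1\in\mathcal D_{m}\text{ good}}}|\langle f,h_{I_1,\eta_1}\otimes u_{J_1,\kappa_1}\rangle|^2\frac{\chi_{S(I_1)}\otimes\chi_{S(J_1)}}{\mu_n(S(I_1))\mu_m(S(J_1))}\Big)^{1/2}$$ and $C$ is independent of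 $b$, $f$ and the grids.
   Context: **Measures.** $\mathbb{R}^n,\mathbb{R}^m$ carry the $\ell^\infty$ metric. A Borel measure $\nu$ on $\mathbb{R}^d$ is upper doubling with dominating function $\lambda\colon\mathbb{R}^d\times(0,\infty)\to(0,\infty)$ if $r\mapsto\lambda(x,r)$ is non-decreasing, $\lambda(x,2r)\le C_\lambda\lambda(x,r)$ and $\nu(B(x,r))\le\lambda(x,r)$; $d_\lambda=\log_2C_\lambda$. The dominating functions of $\mu_n,\mu_m$ are $\lambda_n,\lambda_m$. Pairings are bilinear. **Dyadic grids.** Let $\mathcal D^0_n$ be the standard dyadic grid of $\mathbb{R}^n$. A dyadic grid is a family $\{I+\sum_{i:2^{-i}<\ell(I)}2^{-i}w_i:I\in\mathcal D^0_n\}$ with $w_i\in\{0,1\}^n$, $i\in\mathbb{Z}$; only grids without quadrants are used (any strictly increasing sequence of its cubes exhausts $\mathbb{R}^n$). Similarly in $\mathbb{R}^m$. $\operatorname{gen}(I)=k$ if $\ell(I)=2^{-k}$, and $\operatorname{gen}(I\times J)=(\operatorname{gen}(I),\operatorname{gen}(J))$. Fix $\alpha,\beta>0$, let $\gamma_n=\alpha/(2d_{\lambda_n}+2\alpha)$, $\gamma_m=\beta/(2d_{\lambda_m}+2\beta)$, and let $r$ be a fixed (large) positive integer. A cube $I\in\mathcal D_n$ is ($\mathcal D_n'$-)bad if there is $I'\in\mathcal D_n'$ with $\ell(I')\ge2^r\ell(I)$ and $d(I,\partial I')\le4\ell(I)^{\gamma_n}\ell(I')^{1-\gamma_n}$;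 otherwise good. Same in $\mathbb{R}^m$ with $\gamma_m$ and $\mathcal D_m'$. For good $I\in\mathcal D_n$, $S(I)\in\mathcal D_n'$ is the unique cube with $I\subset S(I)$ and $\ell(S(I))=2^r\ell(I)$; similarly $S(J)\in\mathcal D_m'$ for good $J\in\mathcal D_m$. $R=I\times J$ is good if both $I$ and $J$ are. **Haar functions.** Index the dyadic children $I_1,\dots,I_{2^n}$ of $I$ so that $\hat I_k=\bigcup_{u\ge k}I_u$ satisfies $\mu_n(\hat I_k)\ge[1-(k-1)2^{-n}]\mu_n(I)$. For $\eta=1,\dots,2^n-1$, $$h_{I,\eta}=\Big(\frac{\mu_n(I_\eta)\mu_n(\hat I_{\eta+1})}{\mu_n(\hat I_\eta)}\Big)^{1/2}\Big[\frac{\chi_{I_\eta}}{\mu_n(I_\eta)}-\frac{\chi_{\hat I_{\eta+1}}}{\mu_n(\hat I_{\eta+1})}\Big]$$ ($h_{I,\eta}=0$ if $\mu_n(I_\eta)=0$); for a fixed grid these are orthonormal (apart from those that vanish). The functions $u_{J,\kappa}$, $\kappa=1,\dots,2^m-1$, are defined in the same way on $(\mathbb{R}^m,\mu_m)$. In the sums, $\eta_1\in\{1,\dots,2^n-1\}$ and $\kappa_1\in\{1,\dots,2^m-1\}$. **Product BMO.** $b$ is an object (e.g. a locally integrable function, or a linear functional on finite linear combinations of the functions $h_{I,\eta}\otimes u_{J,\kappa}$) whose pairings $\langle b,h_{I,\eta}\otimes u_{J,\kappa}\rangle$ are defined; $\|b\|_{\mathrm{BMO}_{\mathrm{prod}}(\mu)}$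 is the least $L$ such that for all grids $\mathcal D=\mathcal D_n\times\mathcal D_m$, $\mathcal D'=\mathcal D_n'\times\mathcal D_m'$, $$\Big(\sum_{\eta=1}^{2^n-1}\sum_{\kappa=1}^{2^m-1}\sum_{\substack{S\in\mathcal D'\\S\subset\Omega}}\ \sum_{\substack{R=I\times J\in\mathcal D\text{ good},\ R\subset S\\ \operatorname{gen}(R)=\operatorname{gen}(S)+(r,r)}}|\langle b,h_{I,\eta}\otimes u_{J,\kappa}\rangle|^2\Big)^{1/2}\le L\mu(\Omega)^{1/2}$$ for all $\Omega\subset\mathbb{R}^{n+m}$ with $\mu(\Omega)<\infty$ such that every $x\in\Omega$ lies in some $S\in\mathcal D'$ with $S\subset\Omega$. **Interpretation.** $\langle f,h_{I_1,\eta_1}\otimes u_{J_1,\kappa_1}\rangle=\lambda_{I_1J_1}^{\eta_1\kappa_1}$ when $h_{I_1,\eta_1}\otimes u_{J_1,\kappa_1}$ is non-zero, and $0$ otherwise (terms with vanishing Haar functions are omitted). $\langle b,f\rangle$ means the series $\sum\lambda_{I_1J_1}^{\eta_1\kappa_1}\langle b,h_{I_1,\eta_1}\otimes u_{J_1,\kappa_1}\rangle$, whose absolute convergence, when the right-hand side of the inequality is finite, is understood as part of the assertion. *)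

(* Defs.v *)
(* Scalars are complex numbers, R[i] for R : realType; real scalars are a
   special case. *)
From mathcomp Require Import all_boot all_order all_algebra.
From mathcomp Require Import all_classical all_reals all_analysis.
From mathcomp Require Import complex.

Set Implicit Arguments.
Unset Strict Implicit.
Unset Printing Implicit Defensive.

Import Order.TTheory GRing.Theory Num.Theory.
Import numFieldNormedType.Exports.
Import ComplexField.Normc.

Local Open Scope classical_set_scope.
Local Open Scope ring_scope.
Local Open Scope complex_scope.

(* The norm of 'rV[R]_n, hence ball, is that of the l^oo metric. *)
Definition borel (R : realType) (n : nat) :=
  g_sigma_algebraType (@open 'rV[R]_n).

Section UpperDoubling.
Context {R : realType} {n : nat}.

Definition upper_doubling (nu : {measure set (borel R n) -> \bar R})
    (lam : 'rV[R]_n -> R -> R) (Clam : R) : Prop :=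
  [/\ forall x t, 0 < t -> 0 < lam x t,
      forall x s t, 0 < s -> s <= t -> lam x s <= lam x t,
      forall x t, 0 < t -> lam x (2 * t) <= Clam * lam x t &
      forall x t, 0 < t -> (nu (ball x t) <= (lam x t)%:E)%E].

Definition dlam (Clam : R) : R := ln Clam / ln 2.

Definition gam (a Clam : R) : R := a / (2 * dlam Clam + 2 * a).

End UpperDoubling.

Section Cubes.
Context {R : realType} {n : nat}.

(* (a, k) stands for the half-open cube with lower corner a and side 2^-k. *)
Definition cube : Type := ('rV[R]_n * int)%type.

Definition corner (I : cube) : 'rV[R]_n := I.1.
Definition gen (I : cube) : int := I.2.
Definition side (I : cube) : R := 2 ^ (- gen I).
Definition cset (I : cube) : set 'rV[R]_n :=
  [set x | forall j, corner I 0 j <= x 0 j < corner I 0 j + side I].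

Definition std_grid : set cube :=
  [set I | exists p : 'I_n -> int,
     corner I = \row_j (side I * (p j)%:~R)].

(* \sum_(i > k) 2^-i w_i, with i = k + 1 + l; for cubes of generation k,
   the condition 2^-i < l(I) = 2^-k is i > k. *)
Definition grid_shift (w : int -> 'I_n -> bool) (k : int) : 'rV[R]_n :=
  \row_j limn (series (fun l : nat =>
    2 ^ (- (k + 1 + l%:Z)) * (w (k + 1 + l%:Z) j)%:R : R)).

Definition grid_of (w : int -> 'I_n -> bool) : set cube :=
  [set (corner I + grid_shift w (gen I), gen I) | I in std_grid].

Definition no_quadrants (D : set cube) : Prop :=
  forall c : nat -> cube, (forall k, D (c k)) ->
    (forall k, cset (c k) `<` cset (c k.+1)) ->
    \bigcup_k cset (c k) = setT.

Definition dyadic_grid (D : set cube) : Prop :=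
  (exists w, D = grid_of w) /\ no_quadrants D.

Definition set_dist (A B : set 'rV[R]_n) : R :=
  inf [set `|x - y| | x in A & y in B].

Definition boundary (A : set 'rV[R]_n) : set 'rV[R]_n :=
  closure A `\` interior A.

Definition bad (g : R) (r : nat) (D' : set cube) (I : cube) : Prop :=
  exists2 I' : cube, D' I' &
    2 ^+ r * side I <= side I' /\
    set_dist (cset I) (boundary (cset I')) <=
      4 * side I `^ g * side I' `^ (1 - g).

Definition good (g : R) (r : nat) (D' : set cube) (I : cube) : Prop :=
  ~ bad g r D' I.

(* S(I); the default value I is never reached for good cubes. *)
Definition Sof (r : nat) (D' : set cube) (I : cube) : cube :=
  xget I [set K | [/\ D' K, cset I `<=` cset K & side K = 2 ^+ r * side I]].

End Cubes.
Arguments cube : clear implicits.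

Section Haar.
Context {R : realType} {n : nat}.
Variable mu : {measure set (borel R n) -> \bar R}.

Definition children (I : cube R n) : set (cube R n) :=
  [set (corner I + \row_j (side I / 2 * (e j)%:R), gen I + 1)
    | e in [set: 'I_n -> bool]].

Variable ch : cube R n -> 'I_(2 ^ n) -> cube R n.

(* Union of the children of index >= k, counting from 0. *)
Definition hat (I : cube R n) (k : nat) : set 'rV[R]_n :=
  \bigcup_(u in [set u : 'I_(2 ^ n) | (k <= u)%N]) cset (ch I u).

(* Indices start from 0, so 1 - (k - 1) 2^-n becomes 1 - k 2^-n. *)
Definition children_indexing : Prop :=
  forall I : cube R n,
    set_bij [set: 'I_(2 ^ n)] (children I) (ch I) /\
    forall k : 'I_(2 ^ n),
      ((1 - k%:R / 2 ^+ n)%:E * mu (cset I) <= mu (hat I k))%E.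

Definition hidx : Type := 'I_(2 ^ n - 1).

Definition haar (I : cube R n) (eta : hidx) (x : 'rV[R]_n) : R :=
  let A := cset (ch I (widen_ord (leq_subr 1 (2 ^ n)) eta)) in
  let a := fine (mu A) in
  let b := fine (mu (hat I eta.+1)) in
  let c := fine (mu (hat I eta)) in
  if a == 0 then 0
  else Num.sqrt (a * b / c) * (\1_A x / a - \1_(hat I eta.+1) x / b).

End Haar.
Arguments hidx : clear implicits.

Section Series.
Context {R : realType} {T : choiceType}.

Definition abs_summable (D : set T) (a : T -> R[i]) : Prop :=
  summable D (fun t => (normc (a t))%:E).

(* Sum of a real family, as in the library's summable_eseries_esum. *)
Definition rsum (D : set T) (a : T -> R) : R :=
  fine (esum D (fun t => (a t)%:E)^\+ - esum D (fun t => (a t)%:E)^\-)%E.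

(* The value of the series when abs_summable D a holds. *)
Definition csum (D : set T) (a : T -> R[i]) : R[i] :=
  Complex (rsum D (fun t => complex.Re (a t)))
          (rsum D (fun t => complex.Im (a t))).

End Series.

Section BiParameter.
Context {R : realType} {n m : nat}.
Variables (mun : {measure set (borel R n) -> \bar R})
          (mum : {measure set (borel R m) -> \bar R}).
Variables (chn : cube R n -> 'I_(2 ^ n) -> cube R n)
          (chm : cube R m -> 'I_(2 ^ m) -> cube R m).

Definition rect (S : cube R n * cube R m) : set ('rV[R]_n * 'rV[R]_m) :=
  cset S.1 `*` cset S.2.

Definition haar_index : Type :=
  ((cube R n * hidx n) * (cube R m * hidx m))%type.

Definition hu (t : haar_index) (z : 'rV[R]_n * 'rV[R]_m) : R[i] :=
  (haar mun chn t.1.1 t.1.2 z.1 * haar mum chm t.2.1 t.2.2 z.2)%:C.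

Definition haar_span : set ('rV[R]_n * 'rV[R]_m -> R[i]) :=
  [set f | exists s : seq (R[i] * haar_index),
     f = fun z => \sum_(p <- s) p.1 * hu p.2 z].

(* b stands for any object that pairs linearly with the finite linear
   combinations of the functions h (x) u; its values elsewhere play no role. *)
Definition pairing_linear
    (b : ('rV[R]_n * 'rV[R]_m -> R[i]) -> R[i]) : Prop :=
  forall (c : R[i]) f g, haar_span f -> haar_span g ->
    b (fun z => c * f z + g z) = c * b f + b g.

Variables (gn gm : R) (r : nat).

Section Grids.
Variables (Dn Dn' : set (cube R n)) (Dm Dm' : set (cube R m)).

Definition rect_below (S : cube R n * cube R m) : set (cube R n * cube R m) :=
  [set Q | [/\ Dn Q.1 /\ Dm Q.2,
               good gn r Dn' Q.1 /\ good gm r Dm' Q.2,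
               rect Q `<=` rect S &
               gen Q.1 = gen S.1 + r%:Z /\ gen Q.2 = gen S.2 + r%:Z]].

Definition bmo_sum (b : ('rV[R]_n * 'rV[R]_m -> R[i]) -> R[i])
    (Omega : set ('rV[R]_n * 'rV[R]_m)) : \bar R :=
  (\sum_(eta : hidx n) \sum_(kappa : hidx m)
    \esum_(S in [set S : cube R n * cube R m |
                  [/\ Dn' S.1, Dm' S.2 & rect S `<=` Omega]])
    \esum_(Q in rect_below S)
      (normc (b (hu ((Q.1, eta), (Q.2, kappa)))) ^+ 2)%:E)%E.

(* Indices of the terms of f. *)
Definition good_index : set haar_index :=
  [set t | [/\ Dn t.1.1, Dm t.2.1, good gn r Dn' t.1.1 &
               good gm r Dm' t.2.1]].

(* The pairing of f = \sum_t lam t * hu t with hu t. *)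
Definition fcoef (lam : haar_index -> R[i]) (t : haar_index) : R[i] :=
  if `[< hu t = fun=> 0 >] then 0 else lam t.

(* The terms of the series <b, f>. *)
Definition pairing_term (b : ('rV[R]_n * 'rV[R]_m -> R[i]) -> R[i])
    (lam : haar_index -> R[i]) (t : haar_index) : R[i] :=
  fcoef lam t * b (hu t).

(* When S(I) or S(J) is a null set, hu t vanishes and so does fcoef lam t:
   the convention x / 0 = 0 then gives the omitted term the value 0. *)
Definition square_fun (lam : haar_index -> R[i]) (z : 'rV[R]_n * 'rV[R]_m) :
    \bar R :=
  sqrte (\esum_(t in good_index)
    (let SI := cset (Sof r Dn' t.1.1) in
     let SJ := cset (Sof r Dm' t.2.1) in
     normc (fcoef lam t) ^+ 2 *
       (\1_SI z.1 * \1_SJ z.2 / (fine (mun SI) * fine (mum SJ))))%:E).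

End Grids.

Definition bmo_bound (b : ('rV[R]_n * 'rV[R]_m -> R[i]) -> R[i]) (L : R) :
    Prop :=
  forall (Dn Dn' : set (cube R n)) (Dm Dm' : set (cube R m)),
    dyadic_grid Dn -> dyadic_grid Dn' -> dyadic_grid Dm -> dyadic_grid Dm' ->
  forall Omega : set ('rV[R]_n * 'rV[R]_m),
    ((mun \x mum) Omega < +oo)%E ->
    (forall z, Omega z -> exists S : cube R n * cube R m,
       [/\ Dn' S.1, Dm' S.2, rect S z & rect S `<=` Omega]) ->
  (sqrte (bmo_sum Dn Dn' Dm Dm' b Omega) <=
     L%:E * sqrte ((mun \x mum) Omega))%E.

(* +oo when there is no bound; b is in BMO_prod when the value is finite. *)
Definition bmo_norm (b : ('rV[R]_n * 'rV[R]_m -> R[i]) -> R[i]) : \bar R :=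
  ereal_inf [set L%:E | L in [set L : R | 0 <= L /\ bmo_bound b L]].

Definition L1norm (f : 'rV[R]_n * 'rV[R]_m -> \bar R) : \bar R :=
  (\int[mun \x mum]_(z in setT) `|f z|)%E.

End BiParameter.

(* Main.v *)
(* Fix a finite set of indices and let g be the corresponding finite part of
   the square function.  A rectangle S(R) = S(I_1) x S(J_1) is put in level j
   when it is at least half filled by {g > 2^j} but not by {g > 2^(j+1)}
   (Chang-Fefferman).  If U_j is the union of the rectangles of level j, then
   the BMO condition gives sum |b_R|^2 <= L^2 mu(U_j), and since each such
   rectangle is at least half filled by {g <= 2^(j+1)}, the sum of the
   |lambda_R|^2 is at most C 4^j mu(U_j).  Hence level j contributes at most
   C L 2^j mu(U_j), and mu(U_j) <= 16 mu {g > 2^j}, so that the layer-cake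
   formula gives C L int g.

   The last inequality only needs the weak-type bound for unions of one-parameter
   dyadic cubes, used twice: if I x J is half filled by W, then for a quarter
   of the x in I the fibre W_x fills a quarter of J, so that first the cubes J
   and then the cubes I can be covered.  Finite families of dyadic cubes have a
   disjoint subfamily with the same union, so no maximal function appears. *)
Require Import Defs.
From HB Require Import structures.
From mathcomp Require Import all_boot all_order all_algebra.
From mathcomp Require Import all_classical all_reals all_analysis.
From mathcomp Require Import measurable_realfun.
From mathcomp Require Import complex.
From mathcomp Require Import ring lra zify.

Import Order.TTheory GRing.Theory Num.Theory.
Import numFieldNormedType.Exports.
Import ComplexField.Normc.

Local Open Scope classical_set_scope.
Local Open Scope ring_scope.

(** * Weak-type bounds for unions of rectangles *)

Definition nested {T : Type} (A B : set T) : Prop :=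
  [\/ A `<=` B, B `<=` A | A `&` B = set0].

(** Induction on the list. A new set lying inside a selected one is dropped. Otherwise it is
    selected and the selected sets that meet it are discarded: by nestedness they lie inside it. *)
Lemma nested_disjoint_subcover {I : eqType} {T : Type} (F : I -> set T)
    (s : seq I) :
  {in s &, forall i j, nested (F i) (F j)} ->
  exists s' : seq I, [/\ {subset s' <= s},
    \bigcup_(i in [set` s]) F i = \bigcup_(i in [set` s']) F i &
    trivIset [set` s'] F].
Proof.
elim: s => [_|i s IH nest].
  by exists [::]; split => // j k; rewrite /= in_nil.
have [|s' [s's sE tr]] := IH.
  by move=> j k js ks; apply: nest; rewrite in_cons ?js ?ks orbT.
have sc : \bigcup_(j in [set` i :: s]) F j = F i `|` \bigcup_(j in [set` s]) F j.
  apply/seteqP; split => x.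
    move=> [j /=]; rewrite in_cons => /orP[/eqP-> Fx|js Fx]; first by left.
    by right; exists j.
  case=> [Fx|[j js Fx]]; first by exists i => //=; rewrite mem_head.
  by exists j => //=; rewrite in_cons; apply/orP; right.
have [[k ks' Fik]|nsub] := pselect (exists2 k, k \in s' & F i `<=` F k).
  exists s'; split => //.
    by move=> j /s's js; rewrite in_cons js orbT.
  by rewrite sc sE; apply: setUidr => x Fx; exists k => //; apply: Fik.
exists (i :: [seq k <- s' | `[< F k `&` F i = set0 >]]); split.
- move=> j; rewrite !in_cons mem_filter => /orP[->//|/andP[_ /s's ->]].
  by rewrite orbT.
- rewrite sc sE; apply/seteqP; split => x.
    case=> [Fx|[j js' Fx]]; first by exists i => //=; rewrite mem_head.
    have ji : nested (F j) (F i).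
      by apply: nest; rewrite in_cons ?eqxx// (s's _ js') orbT.
    case: ji => [sub|sub|dis].
    + by exists i; [rewrite /= mem_head|apply: sub].
    + by exfalso; apply: nsub; exists j.
    + exists j => //=; rewrite in_cons mem_filter js' andbT.
      by apply/orP; right; apply/asboolP.
  move=> [j /=]; rewrite in_cons mem_filter => /orP[/eqP-> Fx|/andP[_ js'] Fx].
    by left.
  by right; exists j.
- move=> j k /=; rewrite !in_cons !mem_filter.
  case/orP=> [/eqP->|/andP[/asboolP jD js']];
  case/orP=> [/eqP->|/andP[/asboolP kD ks']] // [x [Fj Fk]].
  + by exfalso; have : (F k `&` F i) x by []; rewrite kD.
  + by exfalso; have : (F j `&` F i) x by []; rewrite jD.
  + by apply: tr => //; exists x.
Qed.

Section weak_type.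
Local Open Scope ereal_scope.

(** On a disjoint subfamily with the same union the hypotheses can be added up, and the traces [F i]
    on [W] are disjoint subsets of [W]. *)
Lemma nested_cover_le {d} {T : measurableType d} {R : realType}
    (mu : {measure set T -> \bar R}) {I : choiceType} (F : I -> set T)
    (s : seq I) (W : set T) (c : \bar R) :
  0 <= c -> measurable W -> {in s, forall i, measurable (F i)} ->
  {in s &, forall i j, nested (F i) (F j)} ->
  {in s, forall i, mu (F i) <= c * mu (F i `&` W)} ->
  mu (\bigcup_(i in [set` s]) F i) <= c * mu W.
Proof.
move=> c0 mW mF nest le.
have [s' [s's -> tr]] := nested_disjoint_subcover F s nest.
have fs' : finite_set [set` s'] by exact: finite_seq.
have mFI i : [set` s'] i -> measurable (F i `&` W).
  by move=> /= /s's is_; apply: measurableI => //; apply: mF.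
rewrite measure_fin_bigcup//; last by move=> i /= /s's; exact: mF.
apply: (@le_trans _ _ (\sum_(i \in [set` s']) (c * mu (F i `&` W)))).
  by apply: lee_fsum => // i /= /s's; exact: le.
rewrite -ge0_mule_fsumr; last by move=> i; exact: measure_ge0.
rewrite lee_wpmul2l// -measure_fin_bigcup//; last first.
  by apply: trivIset_setIr.
apply: le_measure; rewrite ?inE//; first exact: fin_bigcup_measurable.
by apply: bigcup_sub => i _ x [].
Qed.

End weak_type.

(** * Weak-type bound in two parameters *)

Section product_weak_type.
Local Open Scope ereal_scope.
Context {d1 d2 : measure_display} {T1 : measurableType d1}
  {T2 : measurableType d2} {R : realType}.
Variables (m1 : {sigma_finite_measure set T1 -> \bar R})
  (m2 : {sigma_finite_measure set T2 -> \bar R}).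

(** Tonelli for sets: [m1 \x m2] integrates the measures of [xsection], whereas covering in the
    first variable needs slices at fixed [y]. The two iterated integrals agree because they do so on
    rectangles. *)
Lemma product_measure_symE (W : set (T1 * T2)) : measurable W ->
  (m1 \x m2) W = \int[m2]_y m1 (ysection W y).
Proof.
move=> mW; rewrite (product_measure_unique (m' := m1 \x^ m2))// => A B mA mB.
by rewrite /= product_measure2E.
Qed.

Lemma measurable_dense_fibres (A : set T1) (B : set T2) (W : set (T1 * T2)) :
  measurable A -> measurable B -> measurable W ->
  measurable (A `&` [set x | m2 B <= 4%:E * m2 (B `&` xsection W x)]).
Proof.
move=> mA mB mW; apply: measurable_lee => //; apply: measurable_funeM.
apply: (@measurable_funS _ _ _ _ setT) => //.
have secE x : B `&` xsection W x = xsection ((setT `*` B) `&` W) x.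
  by apply/seteqP; split=> y; rewrite /xsection /= !inE /= => -[] // [].
under eq_fun do rewrite secE.
apply: (measurable_fun_xsection m2); apply: measurableI => //.
exact: measurableX.
Qed.

(** With X the set on the right, the fibres of [W] in [B] have measure at most [m2 B] over X and
    less than a quarter of it over the rest of [A]. Hence half of [m1 A * m2 B] is at most
    [m2 B * m1 X] plus a quarter of [m1 A * m2 B]; then divide by [m2 B]. *)
Lemma dense_fibres_quarter (A : set T1) (B : set T2) (W : set (T1 * T2)) :
  measurable A -> measurable B -> measurable W ->
  m1 A < +oo -> m2 B < +oo ->
  m1 A * m2 B <= 2%:E * (m1 \x m2) ((A `*` B) `&` W) ->
  m1 A <= 4%:E * m1 (A `&` [set x | m2 B <= 4%:E * m2 (B `&` xsection W x)]).
Proof.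
move=> mA mB mW A_oo B_oo AB.
have mBW x : measurable (B `&` xsection W x).
  by apply: measurableI => //; exact: measurable_xsection.
have mX := measurable_dense_fibres A B W mA mB mW.
set X := A `&` _ in mX *.
(* When [B] is null the division is impossible, but then every point of [A] qualifies trivially. *)
have [b0|b0] := eqVneq (m2 B) 0.
  suff -> : X = A by rewrite lee_pemull// ?lee_fin// ler1n.
  by rewrite /X b0; apply/setIidl => x _ /=; rewrite mule_ge0.
have fA : m1 A \is a fin_num by rewrite ge0_fin_numE.
have fB : m2 B \is a fin_num by rewrite ge0_fin_numE.
have XA : m1 X <= m1 A by apply: le_measure; rewrite ?inE//; exact: subIsetl.
have fX : m1 X \is a fin_num by rewrite ge0_fin_numE// (le_lt_trans XA).
have {}b0 : (0 < fine (m2 B))%R.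
  by rewrite fine_gt0// lt0e b0 measure_ge0.
have q0 : 0 <= (4^-1)%:E * m2 B by apply: mule_ge0 => //; rewrite lee_fin.
have key : (m1 \x m2) ((A `*` B) `&` W) <=
    m2 B * m1 X + (4^-1)%:E * m2 B * m1 A.
  have -> : m2 B * m1 X + (4^-1)%:E * m2 B * m1 A =
      \int[m1]_x (m2 B * (\1_X x)%:E + (4^-1)%:E * m2 B * (\1_A x)%:E).
    have mI (Y : set T1) : measurable Y ->
        measurable_fun setT (fun x => (\1_Y x)%:E : \bar R).
      by move=> mY; exact: measurableT_comp.
    have I0 (Y : set T1) x : 0 <= (\1_Y x)%:E :> \bar R by rewrite lee_fin.
    rewrite ge0_integralD ?ge0_integralZl ?integral_indic ?setIT//;
      try (by apply: measurable_funeM; exact: (mI _ mX));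
      try (by apply: measurable_funeM; exact: (mI _ mA));
      try exact: (mI _ mA); try exact: (mI _ mX); by move=> x _; apply: mule_ge0.
  apply: ge0_le_integral => //.
  - apply: (measurable_fun_xsection m2); apply: measurableI => //.
    exact: measurableX.
  - apply: emeasurable_funD; apply: measurable_funeM; exact: measurableT_comp.
  move=> x _ /=.
  have [xA|xA] := pselect (A x); last first.
    rewrite (_ : xsection _ x = set0) ?measure0; last first.
      by apply/seteqP; split=> y //; rewrite /xsection /= inE /= => -[[]].
    by apply: adde_ge0; apply: mule_ge0; rewrite // lee_fin.
  have -> : xsection ((A `*` B) `&` W) x = B `&` xsection W x.
    by apply/seteqP; split=> y; rewrite /xsection /= !inE /= => -[] // [].
  rewrite [X in _ + _ * X](_ : _ = 1) ?mule1; last first.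
    by rewrite indicE mem_set.
  have leB : m2 (B `&` xsection W x) <= m2 B.
    by apply: le_measure; rewrite ?inE//; exact: subIsetl.
  have [xX|xX] := pselect (X x).
    by rewrite indicE mem_set// mule1 (le_trans leB)// leeDl// mule_ge0.
  rewrite indicE memNset// mule0 add0e.
  have fBW : m2 (B `&` xsection W x) \is a fin_num.
    by rewrite ge0_fin_numE// (le_lt_trans leB).
  have : ~ (m2 B <= 4%:E * m2 (B `&` xsection W x)) by move=> h; apply: xX.
  rewrite -(fineK fB) -(fineK fBW) -!EFinM !lee_fin => /negP; rewrite -ltNge.
  by lra.
have := le_trans AB (lee_wpmul2l _ key).
rewrite -(fineK fB) -(fineK fA) -(fineK fX) -!EFinM !lee_fin.
move=> /(_ (ler0n _ _)); move: (fine (m1 A)) (fine (m1 X)) (fine _) b0 => a x b b0 h.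
by rewrite -(ler_pM2r b0); lra.
Qed.

(** The intermediate set [E], the union of the [X i * B i], splits the bound into two one-parameter
    ones: [W] controls [E] fibrewise in [y], then [E] controls the full union fibrewise in [x]. Each
    costs a factor 4, whence 16. *)
Lemma product_nested_cover_le {I : choiceType} (A : I -> set T1)
    (B : I -> set T2) (s : seq I) (W : set (T1 * T2)) :
  measurable W ->
  (forall i, measurable (A i)) -> (forall i, measurable (B i)) ->
  (forall i, m1 (A i) < +oo) -> (forall i, m2 (B i) < +oo) ->
  {in s &, forall i j, nested (A i) (A j)} ->
  {in s &, forall i j, nested (B i) (B j)} ->
  {in s, forall i,
    m1 (A i) * m2 (B i) <= 2%:E * (m1 \x m2) ((A i `*` B i) `&` W)} ->
  (m1 \x m2) (\bigcup_(i in [set` s]) (A i `*` B i)) <= 16%:E * (m1 \x m2) W.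
Proof.
move=> mW mA mB A_oo B_oo nA nB ABW.
pose X i := A i `&` [set x | m2 (B i) <= 4%:E * m2 (B i `&` xsection W x)].
have mX i : measurable (X i) by exact: measurable_dense_fibres.
pose E := \bigcup_(i in [set` s]) (X i `*` B i).
pose F := \bigcup_(i in [set` s]) (A i `*` B i).
have mE : measurable E.
  by apply: fin_bigcup_measurable => // i _; exact: measurableX.
have mF : measurable F.
  by apply: fin_bigcup_measurable => // i _; exact: measurableX.
have EW : (m1 \x m2) E <= 4%:E * (m1 \x m2) W.
  rewrite /product_measure1 -ge0_integralZl//; last first.
    exact: (measurable_fun_xsection m2).
  apply: ge0_le_integral => //.
  - exact: (measurable_fun_xsection m2).
  - by apply: measurable_funeM; exact: (measurable_fun_xsection m2).
  move=> x _ /=.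
  (* For fixed [x] only the [B i] with [x] in [X i] occur, and by definition of [X i] each of them
     is a quarter filled by the fibre of [W]. *)
  have -> : xsection E x = \bigcup_(i in [set` [seq i <- s | x \in X i]]) B i.
    apply/seteqP; split=> y.
      rewrite /xsection /= inE => -[i /= si [/= xX yB]]; exists i => //=.
      by rewrite mem_filter si mem_set.
    move=> [i /=]; rewrite mem_filter => /andP[/set_mem xX si] yB.
    by rewrite /xsection /= inE; exists i.
  apply: nested_cover_le => //; first exact: measurable_xsection.
    by move=> i j; rewrite !mem_filter => /andP[_ si] /andP[_ sj]; exact: nB.
  by move=> i; rewrite mem_filter => /andP[/set_mem[]].
have FE : (m1 \x m2) F <= 4%:E * (m1 \x m2) E.
  rewrite !product_measure_symE// -ge0_integralZl//; last first.
    exact: (measurable_fun_ysection m1).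
  apply: ge0_le_integral => //.
  - exact: (measurable_fun_ysection m1).
  - by apply: measurable_funeM; exact: (measurable_fun_ysection m1).
  move=> y _ /=.
  have -> : ysection F y = \bigcup_(i in [set` [seq i <- s | y \in B i]]) A i.
    apply/seteqP; split=> x.
      rewrite /ysection /= inE => -[i /= si [/= xA yB]]; exists i => //=.
      by rewrite mem_filter si mem_set.
    move=> [i /=]; rewrite mem_filter => /andP[/set_mem yB si] xA.
    by rewrite /ysection /= inE; exists i.
  apply: nested_cover_le => //; first exact: measurable_ysection.
    by move=> i j; rewrite !mem_filter => /andP[_ si] /andP[_ sj]; exact: nA.
  move=> i; rewrite mem_filter => /andP[/set_mem yB si].
  (* If [y] lies in [B i], the slice of [E] at [y] contains [X i], which fills a quarter of
     [A i]. *)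
  apply: (le_trans (dense_fibres_quarter _ _ _ (mA i) (mB i) mW _ _ (ABW _ si))) => //.
  rewrite lee_wpmul2l//; apply: le_measure; rewrite ?inE//; first exact: mX.
    by apply: measurableI => //; exact: measurable_ysection.
  move=> x xX; split; first by case: xX.
  by rewrite /ysection /= inE; exists i.
apply: (le_trans FE); rewrite (_ : 16%:E = 4%:E * 4%:E); last first.
  by rewrite -EFinM; congr EFin; lra.
by rewrite -muleA lee_wpmul2l.
Qed.

End product_weak_type.

(** * The level set argument *)

(** A discrete layer-cake formula: the halves of the thresholds below the square root of [y] form a
    geometric sum that does not exceed the largest of these thresholds. *)
Lemma dyadic_levels_le {R : realType} (c : R) (y : R) (M : nat) : 0 < c ->
  0 <= y ->
  \sum_(j < M) c * 2 ^+ j / 2 * ((c * 2 ^+ j) ^+ 2 < y)%R%:R <= Num.sqrt y.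
Proof.
move=> c0 y0.
(* The induction carries a second bound, half of the next threshold [t]: if [t] is still below the
   root, the new sum is at most [t / 2 + t / 2 = t]. *)
suff [] : \sum_(j < M) c * 2 ^+ j / 2 * ((c * 2 ^+ j) ^+ 2 < y)%R%:R
    <= Num.sqrt y /\
  \sum_(j < M) c * 2 ^+ j / 2 * ((c * 2 ^+ j) ^+ 2 < y)%R%:R
    <= c * 2 ^+ M / 2 by [].
elim: M => [|M [IH1 IH2]].
  by rewrite big_ord0 sqrtr_ge0 expr0; split => //; lra.
have cM0 : 0 < c * 2 ^+ M by rewrite mulr_gt0// exprn_gt0.
rewrite big_ord_recr /=; move: (\sum_(j < M) _) IH1 IH2 => S IH1 IH2.
rewrite (exprS 2 M) (mulrCA c 2).
move: (c * 2 ^+ M) cM0 IH2 => t t0 IH2; case: ltP => cy /=; last first.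
  by rewrite mulr0 addr0; split=> //; lra.
have : t < Num.sqrt y.
  by rewrite -(ger0_norm (ltW t0)) -sqrtr_sqr ltr_sqrt// (le_lt_trans _ cy)// sqr_ge0.
by move=> ?; split; lra.
Qed.

(** Supplies a finite range of levels: at the lowest every set of the family lies inside the level
    set, at the highest the level set is empty. *)
Lemma exists_dyadic_range {R : realType} {I : eqType} (s : seq I) (w : I -> R) :
  {in s, forall i, 0 < w i} ->
  exists c : R, exists M : nat, [/\ 0 < c, {in s, forall i, c ^+ 2 < w i} &
    \sum_(i <- s) w i <= (c * 2 ^+ M) ^+ 2].
Proof.
move=> w0.
have [e e0 ew] : exists2 e : R, 0 < e & {in s, forall i, e < w i}.
  elim: s w0 => [_|i s IH w0]; first by exists 1.
  have [|e e0 es] := IH.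
    by move=> j js; apply: w0; rewrite in_cons js orbT.
  exists (Num.min e (w i / 2)).
    by rewrite lt_min e0 divr_gt0// w0// mem_head.
  move=> j; rewrite in_cons => /orP[/eqP->|/es ej]; rewrite gt_min.
    have : 0 < w i by rewrite w0// mem_head.
    by move=> wi; apply/orP; right; lra.
  by rewrite ej.
(* The sum is below [(N + 1) * e], and [N + 1 < 2 ^ (N + 1)], so [N.+1] doublings of the threshold
   are more than enough. *)
pose N := Num.truncn ((\sum_(i <- s) w i) / e).
exists (Num.sqrt e), N.+1; split; first by rewrite sqrtr_gt0.
  by rewrite sqr_sqrtr ?ltW.
rewrite exprMn sqr_sqrtr; last exact: ltW.
rewrite -ler_pdivrMl// mulrC.
apply: (le_trans (ltW (truncnS_gt _))).
rewrite -exprM -natrX ler_nat -/N.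
by apply: leq_trans (ltn_expl _ (isT : 1 < 2)%N) _; rewrite leq_exp2l//; lia.
Qed.

Section level_sets.
Local Open Scope ereal_scope.
Context {d : measure_display} {T : measurableType d} {R : realType}.
Variable mu : {measure set T -> \bar R}.

(** The integral of a non-negative function is a supremum over the simple functions below it, and a
    larger function admits more of them. In this form the comparison applies directly to the square
    function, an [esum] over all good indices. *)
Lemma le_integral_ge0 (f g : T -> \bar R) :
  (forall x, 0 <= f x) -> (forall x, f x <= g x) ->
  \int[mu]_x f x <= \int[mu]_x g x.
Proof.
move=> f0 fg; rewrite !ge0_integralTE//; last first.
  by move=> x; exact: le_trans (f0 x) (fg x).
apply: ereal_sup_le => _ [h hf <-]; exists h => //= x.
exact: le_trans (hf x) (fg x).
Qed.

Lemma integral_sum_indic {I : Type} (s : seq I) (P : pred I) (w : I -> R)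
    (E : I -> set T) :
  (forall i, (0 <= w i)%R) -> (forall i, measurable (E i)) ->
  \int[mu]_x (\sum_(i <- s | P i) w i * \1_(E i) x)%:E =
  \sum_(i <- s | P i) (w i)%:E * mu (E i).
Proof.
move=> w0 mE.
rewrite -big_filter -(eq_integral _ (fun x =>
  \sum_(i <- [seq i <- s | P i]) (w i * \1_(E i) x)%:E)); last first.
  by move=> x _; rewrite sumEFin big_filter.
rewrite ge0_integral_sum//; last 2 first.
- move=> i; apply/measurable_EFinP; apply: measurable_funM => //.
- by move=> i x _; rewrite lee_fin mulr_ge0.
apply: eq_bigr => i _.
under eq_integral do rewrite EFinM.
rewrite ge0_integralZl ?lee_fin//.
  by rewrite integral_indic// setIT.
exact: measurableT_comp.
Qed.

End level_sets.

(** * Level set duality for a finite family of sets *)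

Section level_set_duality.
Local Open Scope ereal_scope.
Context {d : measure_display} {T : measurableType d} {R : realType}.
Variable mu : {measure set T -> \bar R}.
Context {I : choiceType}.
Variables (s : seq I) (S : I -> set T) (a b : I -> R) (L : R).
Hypotheses (L0 : (0 < L)%R) (mS : forall i, measurable (S i))
  (S_fin : forall i, mu (S i) < +oo) (S_gt0 : {in s, forall i, 0 < mu (S i)})
  (a_gt0 : {in s, forall i, (0 < a i)%R}) (b_ge0 : forall i, (0 <= b i)%R).

Let U (P : pred I) := \bigcup_(i in [set` [seq i <- s | P i]]) S i.

(** The two main inputs in abstract form: the squared BMO condition on the union of a subfamily, and
    the covering bound of [product_nested_cover_le]. *)
Hypothesis carleson : forall P : pred I,
  (\sum_(i <- s | P i) b i ^+ 2)%:E <= (L ^+ 2)%:E * mu (U P).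
Hypothesis maximal : forall (P : pred I) (W : set T), measurable W ->
  {in s, forall i, P i -> mu (S i) <= 2%:E * mu (S i `&` W)} ->
  mu (U P) <= 16%:E * mu W.

Let v i : R := fine (mu (S i)).
Let w i : R := (a i ^+ 2 / v i)%R.
Let G x : R := (\sum_(i <- s) w i * \1_(S i) x)%R.

Let vE i : mu (S i) = (v i)%:E.
Proof. by rewrite /v fineK// ge0_fin_numE. Qed.

Let v_ge0 i : (0 <= v i)%R. Proof. exact: fine_ge0. Qed.

Let v_gt0 i : i \in s -> (0 < v i)%R.
Proof. by move=> /S_gt0; rewrite vE lte_fin. Qed.

Let w_ge0 i : (0 <= w i)%R. Proof. by rewrite divr_ge0// sqr_ge0. Qed.

Let w_gt0 i : i \in s -> (0 < w i)%R.
Proof. by move=> si; rewrite divr_gt0 ?v_gt0// exprn_gt0// a_gt0. Qed.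

Let G_ge0 x : (0 <= G x)%R.
Proof. by apply: sumr_ge0 => i _; rewrite mulr_ge0. Qed.

Let G_ge i x : i \in s -> S i x -> (w i <= G x)%R.
Proof.
move=> si Sx; rewrite /G (big_rem i)//= indicE mem_set// mulr1 lerDl.
by apply: sumr_ge0 => j _; rewrite mulr_ge0.
Qed.

Let mG : measurable_fun setT G.
Proof. by apply: measurable_sum => i; apply: measurable_funM. Qed.

(** [G] is the square of the square function, so the threshold is squared as well. *)
Let Om (c : R) := [set x | (c ^+ 2 < G x)%R].

Let mOm c : measurable (Om c).
Proof.
rewrite (_ : Om c = setT `&` [set x | (c ^+ 2)%:E < (G x)%:E]).
  by apply: emeasurable_fun_o_infty => //; exact/measurable_EFinP.
by apply/seteqP; split=> x /=; rewrite lte_fin => //; case.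
Qed.

Let mU P : measurable (U P).
Proof. by apply: fin_bigcup_measurable => //; exact: finite_seq. Qed.

Let U_fin P : mu (U P) < +oo.
Proof.
apply: (@le_lt_trans _ _ (\sum_(i \in [set` [seq i <- s | P i]]) mu (S i))).
  by apply: content_sub_fsum => //; exact: finite_seq.
by apply: lte_sum_pinfty => i _ ; rewrite S_fin.
Qed.

Let heavy (c : R) i := mu (S i) <= 2%:E * mu (S i `&` Om c).

(** With M the measure of [U P], the squares of the [b i] sum to at most [L ^ 2 * M] and those of
    the [a i] to at most [8 * c ^ 2 * M]. The weighted AM-GM inequality gives
    [(4 + 1/2) * c * L * M], and the factor 16 of [maximal] turns 9/2 into 72. *)
Let level_bound (c : R) (P : pred I) : (0 < c)%R ->
  (forall i, i \in s -> P i -> heavy c i && ~~ heavy (2 * c) i) ->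
  (\sum_(i <- s | P i) a i * b i)%:E <= (72 * L * c)%:E * mu (Om c).
Proof.
move=> c0 hP.
have c_ge0 := ltW c0.
have L_ge0 := ltW L0.
have mUP : mu (U P) <= 16%:E * mu (Om c).
  by apply: maximal => // i si Pi; have /andP[] := hP _ si Pi.
have fU : mu (U P) \is a fin_num by rewrite ge0_fin_numE.
set M := fine (mu (U P)).
have ME : mu (U P) = M%:E by rewrite fineK.
have M0 : (0 <= M)%R by exact: fine_ge0.
have b2 : (\sum_(i <- s | P i) b i ^+ 2 <= L ^+ 2 * M)%R.
  by have := carleson P; rewrite ME -EFinM lee_fin.
(* Half of [S i] lies outside [Om (2 * c)], so [a i ^ 2 = w i * v i] is at most [2 * w i] times the
   measure of that part. Off [Om (2 * c)] the weighted indicators add up to at most [G], hence to at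
   most [4 * c ^ 2]; integrating over [U P] gives the 8. *)
have a2 : (\sum_(i <- s | P i) a i ^+ 2 <= 8 * c ^+ 2 * M)%R.
  rewrite -lee_fin -sumEFin.
  apply: (@le_trans _ _
    (\sum_(i <- s | P i) (2 * w i)%:E * mu (S i `\` Om (2 * c)))).
    rewrite big_seq_cond [leRHS]big_seq_cond; apply: lee_sum => i /andP[si Pi].
    have /andP[_] := hP _ si Pi; rewrite /heavy -ltNge.
    have mSO : measurable (S i `&` Om (2 * c)) by exact: measurableI.
    have fI : mu (S i `&` Om (2 * c)) \is a fin_num.
      rewrite ge0_fin_numE//; apply: le_lt_trans (S_fin i).
      by apply: le_measure; rewrite ?inE//; exact: subIsetl.
    have -> : mu (S i `\` Om (2 * c)) =
        (v i - fine (mu (S i `&` Om (2 * c))))%:E.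
      rewrite EFinB -vE fineK//; apply: measureD => //; exact: S_fin.
    rewrite -(fineK fI) vE -EFinM lte_fin lee_fin.
    move=> h; rewrite -[leLHS](@mulfVK _ (v i)) ?gt_eqF ?v_gt0// -/(w i).
    have := w_gt0 _ si.
    by move: (fine _) h => /= t h w0; nra.
  rewrite -integral_sum_indic//; last 2 first.
  - by move=> i; rewrite mulr_ge0.
  - by move=> i; exact: measurableD.
  have -> : (8 * c ^+ 2 * M)%:E =
      (8 * c ^+ 2)%:E * \int[mu]_x (\1_(U P) x)%:E.
    by rewrite integral_indic// setIT EFinM ME.
  rewrite -ge0_integralZl//; last 2 first.
  - exact: measurableT_comp.
  - by rewrite lee_fin mulr_ge0// sqr_ge0.
  apply: le_integral_ge0 => x.
    by rewrite lee_fin; apply: sumr_ge0 => i _; rewrite mulr_ge0// mulr_ge0.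
  rewrite -EFinM lee_fin.
  have [xU|xU] := pselect (U P x); last first.
    rewrite big_seq_cond big1 ?mulr_ge0 ?sqr_ge0// => i /andP[si Pi].
    rewrite indicE memNset ?mulr0// => -[Sx _]; apply: xU; exists i => //=.
    by rewrite mem_filter Pi.
  rewrite [in leRHS]indicE mem_set// mulr1.
  have [xO|xO] := pselect (Om (2 * c) x).
    rewrite big1 ?mulr_ge0 ?sqr_ge0// => i _.
    by rewrite indicE memNset ?mulr0// => -[].
  move: xO => /negP; rewrite -leNgt => Gx.
  apply: (@le_trans _ _ (2 * G x)%R); last by rewrite exprMn in Gx; lra.
  rewrite /G big_mkcond mulr_sumr; apply: ler_sum => i _.
  case: (P i); last by rewrite mulr_ge0// mulr_ge0.
  rewrite -mulrA ler_wpM2l// ler_wpM2l// !indicE ler_nat.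
  by rewrite in_setD; case: (x \in S i); rewrite ?leq_b1.
(* AM-GM: [a b <= (c L / 2) (a^2 / c^2 + b^2 / L^2)] *)
have ab : (\sum_(i <- s | P i) a i * b i <= 9 / 2 * (c * L) * M)%R.
  apply: (@le_trans _ _ (\sum_(i <- s | P i)
      (L / (2 * c) * a i ^+ 2 + c / (2 * L) * b i ^+ 2))%R).
    apply: ler_sum => i _; rewrite -subr_ge0.
    rewrite (_ : (_ - _ = (L * a i - c * b i) ^+ 2 / (2 * c * L))%R).
      by rewrite divr_ge0 ?sqr_ge0// !mulr_ge0// ltW.
    by field; rewrite !gt_eqF.
  rewrite big_split /= -!mulr_sumr.
  have -> : (9 / 2 * (c * L) * M =
    L / (2 * c) * (8 * c ^+ 2 * M) + c / (2 * L) * (L ^+ 2 * M))%R.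
    by field; rewrite !gt_eqF.
  by rewrite lerD// ler_wpM2l// divr_ge0// ?mulr_ge0// ltW.
apply: (@le_trans _ _ ((9 / 2 * (c * L))%:E * mu (U P))).
  by rewrite ME -EFinM lee_fin.
apply: (le_trans (lee_wpmul2l _ mUP)).
  by rewrite lee_fin !mulr_ge0// ltW.
rewrite muleA -EFinM (_ : (9 / 2 * (c * L) * 16 = 72 * L * c)%R)//.
by field.
Qed.

Lemma level_set_duality :
  (\sum_(i <- s) a i * b i)%:E <=
  (144 * L)%:E * \int[mu]_x (Num.sqrt (\sum_(i <- s)
     a i ^+ 2 / fine (mu (S i)) * \1_(S i) x))%:E.
Proof.
have [c [M [c0 cw wM]]] := exists_dyadic_range s w w_gt0.
pose cj (j : nat) := (c * 2 ^+ j)%R.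
have cj0 j : (0 < cj j)%R by rewrite mulr_gt0// exprn_gt0.
have heavy0 i : i \in s -> heavy (cj 0%N) i.
  move=> si; rewrite /heavy (_ : S i `&` _ = S i).
    by rewrite lee_pemull// lee_fin ler1n.
  apply/setIidl => x Sx; rewrite /Om /= /cj expr0 mulr1.
  by rewrite (lt_le_trans (cw _ si))// G_ge.
have heavyM i : i \in s -> ~~ heavy (cj M) i.
  move=> si; rewrite /heavy (_ : S i `&` _ = set0).
    by rewrite measure0 mule0 -ltNge S_gt0.
  apply/seteqP; split => // x [_]; rewrite /Om /= ltNge => /negP; apply.
  apply: le_trans wM; apply: ler_sum => j _.
  by rewrite ler_piMr// indicE lern1 leq_b1.
(* Heaviness holds at level 0 and fails at level [M], so it is lost between two consecutive
   levels. *)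
have crossing i : i \in s -> exists2 j, (j < M)%N &
    heavy (cj j) i && ~~ heavy (cj j.+1) i.
  move=> si; move: (heavyM _ si).
  elim: M {wM heavyM} => [|M IH]; first by rewrite heavy0.
  case: (boolP (heavy (cj M) i)) => [hM nh|/IH[j jM hj] _].
    by exists M; rewrite // hM.
  by exists j => //; rewrite ltnS ltnW.
have cjS j : cj j.+1 = (2 * cj j)%R by rewrite /cj exprS; ring.
apply: (@le_trans _ _ (\sum_(j < M) (72 * L * cj j)%:E * mu (Om (cj j)))).
  (* All terms are non-negative, so it is enough that each index occurs in at least one level. *)
  apply: (@le_trans _ _ (\sum_(j < M) (\sum_(i <- s |
      heavy (cj j) i && ~~ heavy (cj j.+1) i) a i * b i)%:E)).
    rewrite sumEFin lee_fin.
    under [leRHS]eq_bigr do rewrite big_mkcond.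
    rewrite exchange_big /= big_seq [leRHS]big_seq; apply: ler_sum => i si.
    have [j jM hj] := crossing _ si.
    have ab0 : (0 <= a i * b i)%R by rewrite mulr_ge0// ltW// a_gt0.
    rewrite (bigD1 (Ordinal jM))//= hj lerDl; apply: sumr_ge0 => k _.
    by case: ifP.
  apply: lee_sum => j _; apply: level_bound => // i si.
  by rewrite cjS.
(* The thresholds are halved to match [dyadic_levels_le], which doubles 72 to 144. *)
have -> : \sum_(j < M) (72 * L * cj j)%:E * mu (Om (cj j)) =
    (144 * L)%:E * \sum_(j < M) (cj j / 2)%:E * mu (Om (cj j)).
  rewrite ge0_sume_distrr; last first.
    by move=> j _; rewrite mule_ge0// lee_fin ltW// divr_gt0.
  by apply: eq_bigr => j _; rewrite muleA -EFinM; congr (_%:E * _); field.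
rewrite lee_wpmul2l//; first by rewrite lee_fin mulr_ge0// ltW.
rewrite -integral_sum_indic//; last by move=> j; rewrite ltW// divr_gt0.
apply: le_integral_ge0 => x.
  rewrite lee_fin sumr_ge0// => j _; rewrite mulr_ge0//.
  by rewrite ltW// divr_gt0.
rewrite lee_fin; apply: le_trans (dyadic_levels_le c (G x) M c0 (G_ge0 x)).
apply: ler_sum => j _; rewrite indicE.
suff -> : (x \in Om (cj j)) = ((cj j) ^+ 2 < G x)%R by [].
by apply/idP/idP; rewrite inE.
Qed.

End level_set_duality.

(** * Dyadic cubes *)

Section grid_geometry.
Context {R : realType} {n : nat}.
Implicit Types (I J K : cube R n) (w : int -> 'I_n -> bool).

Lemma side_gt0 I : 0 < side I. Proof. exact: exprz_gt0. Qed.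

Lemma measurable_cset I : measurable (cset I : set (borel R n)).
Proof.
have mlt (j : 'I_n) (t : R) : measurable ([set x | x 0 j < t] : set (borel R n)).
  apply: sub_sigma_algebra.
  rewrite -[X in open X]/((fun x : 'rV[R]_n => x 0 j) @^-1` [set y | y < t]).
  by apply: open_comp => [x _|]; [exact: coord_continuous|exact: open_lt].
rewrite (_ : cset I = \bigcap_(j in [set: 'I_n])
  (~` [set x | x 0 j < corner I 0 j] `&`
   [set x | x 0 j < corner I 0 j + side I])); last first.
  apply/seteqP; split=> [x xI j _|x xI j].
    by have /andP[? ?] := xI j; split => //=; apply/negP; rewrite -leNgt.
  by have [/= /negP + ->] := xI j Logic.I; rewrite -leNgt => ->.
apply: fin_bigcap_measurable => // j _.
by apply: measurableI; [apply: measurableC|]; exact: mlt.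
Qed.

Lemma cset_sub_ball I : cset I `<=` ball (corner I) (2 * side I).
Proof.
have s0 := side_gt0 I.
move=> x xI; split; first by rewrite mulr_gt0.
move=> i j; rewrite !ord1 /ball /= ltr_norml.
by have /andP[? ?] := xI j; apply/andP; split; lra.
Qed.

Lemma cset_child I J : children I J -> cset J `<=` cset I.
Proof.
have s0 := side_gt0 I.
move=> [e _ <-] x xJ j; have := xJ j.
rewrite /corner /side /gen /= !mxE.
rewrite opprD expfzDr// -/(gen I) -/(side I) -/(corner I).
rewrite (_ : 2 ^ (- 1) = 2^-1 :> R)//.
move: (corner I 0 j) (side I) (x 0 j) s0 => c s y s0.
by case: (e j); rewrite ?mulr1 ?mulr0 => /andP[? ?]; apply/andP; split; lra.
Qed.

Let shift_term w (k : int) (j : 'I_n) (l : nat) : R :=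
  2 ^ (- (k + 1 + l%:Z)) * (w (k + 1 + l%:Z) j)%:R.

Let is_cvg_shift w k j : cvgn (series (shift_term w k j)).
Proof.
apply: (@series_le_cvg _ _ (geometric (2 ^ (- (k + 1)) : R) 2^-1)).
- by move=> l; rewrite mulr_ge0// exprz_ge0.
- by move=> l; rewrite /geometric /= mulr_ge0// ?exprz_ge0// exprn_ge0.
- move=> l; rewrite /shift_term /= opprD expfzDr//.
  rewrite -[leRHS]mulr1 ler_pM//.
  + by rewrite mulr_ge0 ?exprz_ge0.
  + by rewrite exprVn exprnN.
  + by rewrite lern1 leq_b1.
by apply: is_cvg_geometric_series; rewrite ger0_norm// invf_lt1// ltr1n.
Qed.

Lemma grid_shiftS w k j : grid_shift w k 0 j =
  2 ^ (- (k + 1)) * (w (k + 1) j)%:R + grid_shift w (k + 1) 0 j :> R.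
Proof.
rewrite /grid_shift !mxE -/(shift_term w k j) -/(shift_term w (k + 1) j).
apply: cvg_lim => //; rewrite -cvg_shiftS /=.
under eq_fun => l.
  rewrite /series /= big_nat_recl//.
  rewrite {1}/shift_term addr0.
  under eq_bigr => i _.
    rewrite (_ : shift_term w k j i.+1 = shift_term w (k + 1) j i); last first.
      by rewrite /shift_term (_ : k + 1 + i.+1%:Z = k + 1 + 1 + i%:Z)//; lia.
    over.
  over.
by apply: cvgD; [exact: cvg_cst|exact: is_cvg_shift].
Qed.

(** The series for generation [k + d] lacks the terms with [k < i <= k + d], and each of these is an
    integer multiple of the finer side. *)
Lemma grid_shift_diff w k (d : nat) j : exists z : int,
  grid_shift w k 0 j = 2 ^ (- (k + d%:Z)) * z%:~R + grid_shift w (k + d%:Z) 0 j :> R.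
Proof.
elim: d => [|d [z zE]]; first by exists 0; rewrite addr0 mulr0 add0r.
exists (2 * z + (w (k + d%:Z + 1) j : nat)%:Z).
rewrite zE grid_shiftS (_ : k + d.+1%:Z = k + d%:Z + 1); last by lia.
rewrite addrA; congr (_ + _).
rewrite rmorphD rmorphM /= mulrDr; congr (_ + _).
rewrite (opprD (k + d%:Z)) expfzDr// -mulrA; congr (_ * _).
by rewrite (_ : 2 ^ (- 1) = 2^-1 :> R)// mulrA mulVf// mul1r.
Qed.

(** Puts the corner of a coarse cube on the shifted lattice of a finer generation, so that two cubes
    can be compared through integers. *)
Lemma grid_cornerP w I k (d : nat) : grid_of w I -> k = gen I + d%:Z ->
  exists a : 'I_n -> int,
    forall j, corner I 0 j = 2 ^ (- k) * (a j)%:~R + grid_shift w k 0 j :> R.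
Proof.
move=> [I0 [p pE] <-] ->; rewrite /gen /=.
have zP (j : 'I_n) := cid (grid_shift_diff w I0.2 d j).
exists (fun j => (2 ^+ d * p j) + projT1 (zP j)) => j.
case: (zP j) => z /= zE.
rewrite /corner /= mxE zE addrA; congr (_ + _).
have := congr1 (fun A : 'rV[R]_n => A 0 j) pE; rewrite /corner mxE => ->.
rewrite rmorphD rmorphM /= mulrDr; congr (_ + _).
rewrite mulrA; congr (_ * _); rewrite /side /gen opprD expfzDr// -mulrA.
by rewrite rmorphXn /= -exprnN mulVf ?mulr1// expf_neq0.
Qed.

Lemma grid_nested_le w I J : grid_of w I -> grid_of w J -> (gen I <= gen J)%R ->
  cset J `<=` cset I \/ cset I `&` cset J = set0.
Proof.
move=> wI wJ IJ.
have [d dE] : exists d : nat, gen J = gen I + d%:Z.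
  by exists `|gen J - gen I|%N; lia.
have [a aE] := grid_cornerP w I (gen J) d wI dE.
have [b bE] := grid_cornerP w J (gen J) 0 wJ (esym (addr0 _)).
have sI : side I = 2 ^ (- gen J) * (2 ^+ d : int)%:~R :> R.
  by rewrite /side dE opprD expfzDr// -mulrA rmorphXn /= -exprnN mulVf ?mulr1//.
have u0 : 0 < 2 ^ (- gen J) :> R by exact: exprz_gt0.
have [[y [yI yJ]]|no] := pselect (exists y, cset I y /\ cset J y); last first.
  by right; apply/seteqP; split => // y [yI yJ]; apply: no; exists y.
left=> x xJ j; have := xJ j; have := yI j; have := yJ j.
rewrite /= aE bE sI /side; move: (grid_shift _ _ _ _) (x 0 j) (y 0 j) => g X Y.
move: (2 ^ (- gen J)) u0 => u u0 /andP[h1 h2] /andP[h3 h4] /andP[h5 h6].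
(* In units of the smaller side the two edges are [[b, b + 1)] and [[a, a + 2 ^ d)]. The common
   point [y] gives strict real inequalities, which integrality sharpens to the inclusion of the
   first in the second. *)
have ab : a j <= b j.
  rewrite -ltzD1 -(ltr_int R) -(ltr_pM2l u0) rmorphD /=; lra.
have ba : b j + 1 <= a j + 2 ^+ d.
  rewrite lezD1 -(ltr_int R) -(ltr_pM2l u0) rmorphD /=; lra.
have {}ab : u * (a j)%:~R <= u * (b j)%:~R by rewrite ler_pM2l// ler_int.
have {ba} : u * (b j + 1)%:~R <= u * (a j + 2 ^+ d)%:~R.
  by rewrite ler_pM2l// ler_int.
by rewrite !rmorphD /= => ba; apply/andP; split; lra.
Qed.

Lemma grid_nested w I J : grid_of w I -> grid_of w J ->
  nested (cset I) (cset J).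
Proof.
move=> wI wJ; case: (leP (gen I) (gen J)) => [|/ltW] IJ.
  by have [?|?] := grid_nested_le w I J wI wJ IJ; [apply: Or32|apply: Or33].
have [?|?] := grid_nested_le w J I wJ wI IJ; first exact: Or31.
by apply: Or33; rewrite setIC.
Qed.

Lemma grid_cover w (x : 'rV[R]_n) k :
  exists I, [/\ grid_of w I, gen I = k & cset I x].
Proof.
pose u : R := 2 ^ (- k); have u0 : 0 < u by exact: exprz_gt0.
pose p j := Num.floor ((x 0 j - grid_shift w k 0 j) / u).
exists ((\row_j (u * (p j)%:~R) + grid_shift w k)%R, k); split => //.
  by exists (\row_j (u * (p j)%:~R), k) => //; exists p.
move=> j; rewrite /corner /side /gen /= -/u mxE [in X in X + _]mxE.
have /andP[] := floor_itv ((x 0 j - grid_shift w k 0 j) / u).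
rewrite -/(p j) ler_pdivlMr// ltr_pdivrMr// rmorphD /= => h1 h2.
by apply/andP; split; lra.
Qed.

End grid_geometry.

(** * Good cubes and their ancestors S(I) *)

Section good_cubes.
Context {R : realType} {n : nat}.
Implicit Types (I K : cube R n) (w : int -> 'I_n -> bool).

Lemma corner_cset I : cset I (corner I).
Proof. by move=> j; rewrite lexx ltrDl side_gt0. Qed.

(* If a cube [I] whose corner lies in [K] sticks out of [K] in direction [j],
   moving the corner of [I] in direction [j] reaches the boundary of [K]
   inside [I]. *)
Lemma cset_meets_boundary I K : cset K (corner I) -> ~ cset I `<=` cset K ->
  exists z, cset I z /\ boundary (cset K) z.
Proof.
move=> KI /existsNP[x /not_implyP[Ix /existsNP[j Kxj]]].
have sK := side_gt0 K.
have [x1 x2] := andP (Ix j); have [k1 k2] := andP (KI j).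
have Kx : corner K 0 j + side K <= x 0 j.
  by rewrite leNgt; apply/negP => h; apply: Kxj; rewrite h (le_trans k1).
pose move_to t : 'rV[R]_n := \row_i (if i == j then t else corner I 0 i).
exists (move_to (corner K 0 j + side K)); split.
  move=> i; rewrite mxE; case: eqP => [->|_].
    by apply/andP; split; lra.
  exact: (corner_cset I i).
(* The point lies on the upper face, which the half-open cube omits, so it is not interior; stepping
   back by a small [t], at most the side of [K], lands in [K], so it is in the closure. *)
split; last first.
  by move=> /interior_subset /(_ j); rewrite mxE eqxx ltxx andbF.
move=> B /nbhs_ballP[e /= e0 eB].
pose t := Num.min (e / 2) (side K).
have t0 : 0 < t by rewrite lt_min divr_gt0.
have te : t <= e / 2 by rewrite ge_min lexx.
have ts : t <= side K by rewrite ge_min lexx orbT.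
exists (move_to (corner K 0 j + side K - t)); split.
  move=> i; rewrite mxE; case: eqP => [->|_]; last exact: (KI i).
  by apply/andP; split; lra.
apply: eB; split => // k i; rewrite /ball /= !mxE; case: eqP => _.
  by rewrite ger0_norm; lra.
by rewrite subrr normr0.
Qed.

(** The grid cube of the right size that contains the corner of [I] must contain all of [I].
    Otherwise its boundary would meet [I], the distance would be 0, and this cube would witness that
    [I] is bad. *)
Lemma good_SofP (g : R) (r : nat) w I : good g r (grid_of w) I ->
  [/\ grid_of w (Sof r (grid_of w) I),
      cset I `<=` cset (Sof r (grid_of w) I) &
      gen I = gen (Sof r (grid_of w) I) + r%:Z].
Proof.
move=> gI.
have sideE K : (side K = 2 ^+ r * side I) <-> (gen I = gen K + r%:Z).
  rewrite /side -[2 ^+ r]/(2 ^ r%:Z) -expfzDr//; split; last first.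
    by move=> ->; congr (_ ^ _); lia.
  have two1 : 2 != 1 :> R by rewrite gt_eqF// ltr1n.
  by move/(ieexprIz (ltr0n _ 2) two1); lia.
suff : [set K | [/\ grid_of w K, cset I `<=` cset K &
    side K = 2 ^+ r * side I]] (Sof r (grid_of w) I) by case=> ? ? /sideE.
apply: xgetPex.
have [K [wK gK Kx]] := grid_cover w (corner I) (gen I - r%:Z).
exists K; split => //; last by apply/sideE; lia.
apply: contrapT => /(cset_meets_boundary _ _ Kx)[z [Iz Kz]].
apply: gI; exists K => //; split.
  by rewrite (sideE K).2// gK; lia.
apply: (@le_trans _ _ 0); last by rewrite !mulr_ge0 ?powR_ge0.
apply: ge_inf; first by exists 0 => _ [x _ [y _ <-]].
by exists z => //; exists z => //; rewrite subrr normr0.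
Qed.

End good_cubes.

(** * Finiteness and positivity of the measure of cubes *)

Section upper_doubling_measure.
Context {R : realType} {n : nat}.
Variables (nu : {measure set (borel R n) -> \bar R})
  (lam : 'rV[R]_n -> R -> R) (C : R).
Hypothesis nu_ud : upper_doubling nu lam C.

Let measurable_ball (x : 'rV[R]_n) (t : R) :
  measurable (ball x t : set (borel R n)).
Proof. by apply: sub_sigma_algebra; exact: ball_open. Qed.

Let ball_fin (x : 'rV[R]_n) (t : R) : 0 < t -> (nu (ball x t) < +oo)%E.
Proof.
by move=> t0; case: nu_ud => _ _ _ /(_ x t t0)/le_lt_trans; apply; rewrite ltry.
Qed.

Lemma upper_doubling_cset_fin (I : cube R n) : (nu (cset I) < +oo)%E.
Proof.
apply: le_lt_trans (ball_fin (corner I) (2 * side I) _).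
  apply: le_measure; rewrite ?inE//; first exact: measurable_cset.
  exact: cset_sub_ball.
by rewrite mulr_gt0// side_gt0.
Qed.

Lemma upper_doubling_sigma_finite : sigma_finite setT nu.
Proof.
exists (fun k => ball (0 : 'rV[R]_n) k.+1%:R).
  apply/esym/seteqP; split=> // x _; exists (Num.truncn `|x|) => //.
  by rewrite mx_norm_ball /ball_ /= sub0r normrN truncnS_gt.
by move=> k; split => //; exact: ball_fin.
Qed.

(** The guard in [haar] returns 0 when the child carrying the first indicator is null, so a non-zero
    value makes that child, and hence [I], charged. *)
Lemma haar_neq0_measure_gt0 ch (I : cube R n) eta x :
  children_indexing nu ch -> haar nu ch I eta x != 0 ->
  (0 < nu (cset I))%E.
Proof.
move=> chP; rewrite /haar; case: ifPn; rewrite ?eqxx// => a0 _.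
set J := ch I _ in a0.
have JI : children I J.
  by have [[+ _ _] _] := chP I; apply.
apply: (@lt_le_trans _ _ (nu (cset J))).
  rewrite lt0e measure_ge0 andbT; apply: contra_neq a0 => ->//.
apply: le_measure; rewrite ?inE//; try exact: measurable_cset.
exact: cset_child.
Qed.

End upper_doubling_measure.

(** * Series and the duality inequality *)

Section sums.
Context {R : realType} {I : choiceType}.

Lemma sqrtr_sum_le {J : Type} (s : seq J) (f : J -> R) :
  (forall j, 0 <= f j) ->
  Num.sqrt (\sum_(j <- s) f j) <= \sum_(j <- s) Num.sqrt (f j).
Proof.
move=> f0; elim: s => [|j s IH]; first by rewrite !big_nil sqrtr0.
rewrite !big_cons.
apply: (@le_trans _ _ (Num.sqrt (f j) + Num.sqrt (\sum_(j <- s) f j))).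
  have S0 : 0 <= \sum_(j <- s) f j by exact: sumr_ge0.
  rewrite -[leRHS]ger0_norm ?addr_ge0 ?sqrtr_ge0// -sqrtr_sqr ler_wsqrtr//.
  rewrite sqrrD !sqr_sqrtr// lerD2r lerDl.
  by rewrite mulrn_wge0// mulr_ge0 ?sqrtr_ge0.
by rewrite lerD2l.
Qed.

Lemma sum_le_esum (s : seq I) (D : set I) (f : I -> \bar R) : uniq s ->
  {in s, forall i, D i} ->
  (\sum_(i <- s) f i <= \esum_(i in D) f i)%E.
Proof.
move=> us sD; apply: esum_ge; exists [set` s].
  by split; [exact: finite_seq|move=> i /= /sD].
by rewrite -fsbig_seq.
Qed.

Lemma esum_le (D : set I) (f : I -> \bar R) (y : \bar R) :
  (forall s : seq I, uniq s -> {in s, forall i, D i} ->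
    (\sum_(i <- s) f i <= y)%E) ->
  (\esum_(i in D) f i <= y)%E.
Proof.
move=> sy; apply: ge_ereal_sup => _ [X [fX XD] <-].
rewrite fsbig_finite//; apply: sy => // i.
by rewrite in_fset_set// inE => /XD.
Qed.

(** The sums of the positive and of the negative parts both lie in [[0, e]], hence their difference
    lies in [[-e, e]]. *)
Lemma normr_rsum_le (D : set I) (f : I -> R) (g : I -> R) (e : R) :
  (forall i, `|f i| <= g i) -> (\esum_(i in D) (g i)%:E <= e%:E)%E ->
  `|rsum D f| <= e.
Proof.
move=> fg ge.
have P0 : (0 <= esum D (fun i => (f i)%:E)^\+)%E by apply: esum_ge0.
have Q0 : (0 <= esum D (fun i => (f i)%:E)^\-)%E by apply: esum_ge0.
have Pe : (esum D (fun i => (f i)%:E)^\+ <= e%:E)%E.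
  apply: le_trans ge; apply: le_esum => i _; rewrite funeposE ge_max.
  by rewrite !lee_fin (le_trans (ler_norm _) (fg i)) (le_trans (normr_ge0 _) (fg i)).
have Qe : (esum D (fun i => (f i)%:E)^\- <= e%:E)%E.
  apply: le_trans ge; apply: le_esum => i _; rewrite funenegE ge_max.
  rewrite !lee_fin (le_trans _ (fg i)) ?(le_trans (normr_ge0 _) (fg i))//.
  by rewrite -normrN ler_norm.
rewrite /rsum.
move: (esum _ _) (esum _ _) P0 Q0 Pe Qe => [p| |] [q| |]//=.
by rewrite !lee_fin => *; rewrite ler_norml; apply/andP; split; lra.
Qed.

(** Real and imaginary parts are bounded separately by [e]; the factor 2 is a crude form of the
    square root of 2. *)
Lemma normc_csum_le (D : set I) (a : I -> R[i]) (e : R) :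
  (\esum_(i in D) (normc (a i))%:E <= e%:E)%E -> normc (csum D a) <= 2 * e.
Proof.
move=> ae; rewrite /normc /csum.
have xe : `|rsum D (fun t => complex.Re (a t))| <= e.
  apply: normr_rsum_le ae => i; rewrite /normc; case: (a i) => x y /=.
  by rewrite -sqrtr_sqr ler_wsqrtr// lerDl sqr_ge0.
have ye : `|rsum D (fun t => complex.Im (a t))| <= e.
  apply: normr_rsum_le ae => i; rewrite /normc; case: (a i) => x y /=.
  by rewrite -sqrtr_sqr ler_wsqrtr// lerDr sqr_ge0.
move: (rsum _ _) (rsum _ _) xe ye => x y xe ye.
rewrite -[leRHS]ger0_norm; last by rewrite mulr_ge0// (le_trans _ xe).
rewrite -sqrtr_sqr ler_wsqrtr// -[x ^+ 2]real_normK ?num_real//.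
rewrite -[y ^+ 2]real_normK ?num_real//.
by have := normr_ge0 x; have := normr_ge0 y; nra.
Qed.

Lemma normc_ge0 (x : R[i]) : 0 <= normc x.
Proof. by case: x => x y; exact: sqrtr_ge0. Qed.

End sums.

Section with_sigma_finite.
Context {d : measure_display} {T : measurableType d} {R : realType}.
Variables (nu : {measure set T -> \bar R}) (h : sigma_finite setT nu).

(** An alias of [nu] indexed by a proof of sigma-finiteness, from which the instance below is built;
    it lets the upper doubling measures enter the product measure. *)
Definition with_sigma_finite of sigma_finite setT nu : set T -> \bar R := nu.

HB.instance Definition _ := Measure.copy (with_sigma_finite h) nu.
HB.instance Definition _ :=
  Measure_isSigmaFinite.Build _ _ _ (with_sigma_finite h) h.

End with_sigma_finite.

(** * Duality for finite sets of Haar indices, and passage to the series *)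

Section finite_duality.
Context {R : realType} {n m : nat}.
Variables (mun : {measure set (borel R n) -> \bar R})
  (mum : {measure set (borel R m) -> \bar R}).
Variables (lamn : 'rV[R]_n -> R -> R) (lamm : 'rV[R]_m -> R -> R) (Cn Cm : R).
Hypotheses (mun_ud : upper_doubling mun lamn Cn)
  (mum_ud : upper_doubling mum lamm Cm).
Variables (chn : cube R n -> 'I_(2 ^ n) -> cube R n)
  (chm : cube R m -> 'I_(2 ^ m) -> cube R m).
Hypotheses (chnP : children_indexing mun chn)
  (chmP : children_indexing mum chm).
Variables (gn gm : R) (r : nat).
Variables (Dn Dn' : set (cube R n)) (Dm Dm' : set (cube R m)).
Hypotheses (DnP : dyadic_grid Dn) (DnP' : dyadic_grid Dn')
  (DmP : dyadic_grid Dm) (DmP' : dyadic_grid Dm').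
Variable b : ('rV[R]_n * 'rV[R]_m -> R[i]) -> R[i].

Local Notation index := (@haar_index R n m).
Local Notation idx := (good_index gn gm r Dn Dn' Dm Dm').
Local Notation hu := (hu mun mum chn chm).

Let Srect (t : index) : cube R n * cube R m :=
  (Sof r Dn' t.1.1, Sof r Dm' t.2.1).

Lemma good_index_SofP (t : index) : idx t ->
  [/\ Dn' (Sof r Dn' t.1.1), cset t.1.1 `<=` cset (Sof r Dn' t.1.1) &
      gen t.1.1 = gen (Sof r Dn' t.1.1) + r%:Z] /\
  [/\ Dm' (Sof r Dm' t.2.1), cset t.2.1 `<=` cset (Sof r Dm' t.2.1) &
      gen t.2.1 = gen (Sof r Dm' t.2.1) + r%:Z].
Proof.
have [[wn Dn'E] _] := DnP'; have [[wm Dm'E] _] := DmP'.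
by case=> _ _; rewrite Dn'E Dm'E => /good_SofP gI /good_SofP gJ.
Qed.

(** Sort the indices by [eta] and [kappa], and place each one in the double sum under the outer
    rectangle [Srect t], which is admissible by [good_index_SofP]. *)
Lemma sum_le_bmo_sum (s : seq index) (Omega : set ('rV[R]_n * 'rV[R]_m)) :
  uniq s -> {in s, forall t, idx t} ->
  {in s, forall t, rect (Srect t) `<=` Omega} ->
  ((\sum_(t <- s) normc (b (hu t)) ^+ 2)%:E <=
    bmo_sum mun mum chn chm gn gm r Dn Dn' Dm Dm' b Omega)%E.
Proof.
move=> us sidx sOm; rewrite -sumEFin.
rewrite (partition_big (fun t : index => t.1.2) xpredT)//=.
apply: lee_sum => eta _.
rewrite (partition_big (fun t : index => t.2.2) xpredT)//=.
apply: lee_sum => kappa _.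
rewrite esum_esum; last by move=> *; rewrite lee_fin sqr_ge0.
rewrite -big_filter; set s' := seq.filter _ s.
pose f (t : index) := (Srect t, (t.1.1, t.2.1)).
have s'E t : t \in s' -> [/\ t \in s, t.1.2 = eta & t.2.2 = kappa].
  by rewrite mem_filter => /andP[/andP[/eqP ? /eqP ?] ?].
rewrite (_ : \sum_(t <- s') (normc (b (hu t)) ^+ 2)%:E =
  \sum_(k <- map f s')
    (normc (b (hu ((k.2.1, eta), (k.2.2, kappa)))) ^+ 2)%:E)%E; last first.
  rewrite big_map big_seq [RHS]big_seq; apply: eq_bigr => -[[I e] [J k]].
  by move=> /s'E[_ /= -> ->].
apply: sum_le_esum.
  (* Within [s'] the labels [eta] and [kappa] are fixed, so the cubes alone determine the index. *)
  rewrite map_inj_in_uniq ?filter_uniq// => -[[I e] [J k]] [[I' e'] [J' k']].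
  by move=> /s'E[_ /= -> ->] /s'E[_ /= -> ->] [_ _ -> ->].
move=> _ /mapP[t /s'E[ts _ _] ->]; have tidx := sidx _ ts.
have [[? sI ?] [? sJ ?]] := good_index_SofP t tidx.
split=> /=; first by split => //; exact: sOm.
case: tidx => ? ? ? ?; split => //.
by move=> z [zI zJ]; split; [exact: sI|exact: sJ].
Qed.

Variable lambda : index -> R[i].
Let coef := fcoef mun mum chn chm lambda.

Let mun' : {sigma_finite_measure set (borel R n) -> \bar R} :=
  with_sigma_finite mun (upper_doubling_sigma_finite _ _ _ mun_ud).
Let mum' : {sigma_finite_measure set (borel R m) -> \bar R} :=
  with_sigma_finite mum (upper_doubling_sigma_finite _ _ _ mum_ud).
Let mu := (mun' \x mum')%E : {measure set _ -> \bar R}.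

Let S (t : index) : set (borel R n * borel R m) := rect (Srect t).

Let mS t : measurable (S t).
Proof. by apply: measurableX; exact: measurable_cset. Qed.

Let muS t : mu (S t) =
  (mun (cset (Sof r Dn' t.1.1)) * mum (cset (Sof r Dm' t.2.1)))%E.
Proof. by apply: product_measure1E; exact: measurable_cset. Qed.

Let cset_fin_n I : (mun (cset I) < +oo)%E.
Proof. exact: upper_doubling_cset_fin mun_ud _. Qed.

Let cset_fin_m I : (mum (cset I) < +oo)%E.
Proof. exact: upper_doubling_cset_fin mum_ud _. Qed.

Let S_fin t : (mu (S t) < +oo)%E.
Proof. by rewrite muS lte_mul_pinfty// ge0_fin_numE. Qed.

(** By [fcoef], a non-zero coefficient forces [hu t] to be non-zero somewhere. Both Haar factors are
    then non-zero there, their cubes are charged, and [S t] contains the product of these cubes. *)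
Let S_gt0 t : idx t -> coef t != 0 -> (0 < mu (S t))%E.
Proof.
move=> tidx; rewrite /coef /fcoef; case: ifPn; rewrite ?eqxx// => /asboolPn hu0 _.
have [[_ sI _] [_ sJ _]] := good_index_SofP t tidx.
have [[x y] huxy] : exists z, hu t z != 0.
  apply: contrapT => no; apply: hu0; apply/funext => z.
  by apply/eqP; apply: contrapT => /negP nz; apply: no; exists z.
have : haar mun chn t.1.1 t.1.2 x * haar mum chm t.2.1 t.2.2 y != 0.
  by apply: contra_neq huxy; rewrite /hu /= => ->.
rewrite mulf_eq0 negb_or => /andP[/(haar_neq0_measure_gt0 _ _ _ _ _ chnP) I0].
move=> /(haar_neq0_measure_gt0 _ _ _ _ _ chmP) J0.
rewrite muS mule_gt0//.
  by apply: (lt_le_trans I0); apply: le_measure; rewrite ?inE//; exact: measurable_cset.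
by apply: (lt_le_trans J0); apply: le_measure; rewrite ?inE//; exact: measurable_cset.
Qed.

Let sqf := square_fun mun mum chn chm gn gm r Dn Dn' Dm Dm' lambda.

Let sf (s : seq index) z :=
  Num.sqrt (\sum_(t <- s) normc (coef t) ^+ 2 / fine (mu (S t)) * \1_(S t) z).

Let sf_le_square_fun s z : uniq s -> {in s, forall t, idx t} ->
  ((sf s z)%:E <= sqf z)%E.
Proof.
move=> us sidx; rewrite /sqf /square_fun.
rewrite -[leLHS]/(sqrte (\sum_(t <- s)
  normc (coef t) ^+ 2 / fine (mu (S t)) * \1_(S t) z)%:E).
rewrite lee_sqrt; last first.
  apply: esum_ge0 => t _ /=.
  by rewrite lee_fin mulr_ge0 ?sqr_ge0// divr_ge0// ?mulr_ge0// ?fine_ge0.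
rewrite -sumEFin; apply: le_trans (sum_le_esum s idx _ us sidx).
rewrite le_eqVlt; apply/orP; left; apply/eqP; apply: eq_bigr => t _; congr EFin.
rewrite muS fineM ?ge0_fin_numE// -mulrA; congr (_ * _).
rewrite mulrC; congr (_ / _); rewrite !indicE -natrM mulnb.
congr (_%:R); congr nat_of_bool.
by apply/idP/andP; rewrite !inE.
Qed.

(** Subadditivity of the square root bounds the integrand by a finite combination of indicators.
    Finiteness allows the small error in the BMO constant to be removed later. *)
Let sf_integral_fin s : (\int[mu]_z (sf s z)%:E < +oo)%E.
Proof.
pose c t := Num.sqrt (normc (coef t) ^+ 2 / fine (mu (S t))).
apply: (@le_lt_trans _ _ (\int[mu]_z (\sum_(t <- s) c t * \1_(S t) z)%:E)%E).
  apply: le_integral_ge0 => z; first by rewrite lee_fin sqrtr_ge0.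
  rewrite lee_fin /sf; apply: (le_trans (sqrtr_sum_le _ _ _)).
    by move=> t; rewrite mulr_ge0// divr_ge0 ?sqr_ge0 ?fine_ge0.
  apply: ler_sum => t _; rewrite /c indicE.
  by case: (_ \in _); rewrite ?mulr1// !mulr0 sqrtr0.
rewrite integral_sum_indic//; last by move=> t; exact: sqrtr_ge0.
by apply: lte_sum_pinfty => t _; rewrite lte_mul_pinfty ?lee_fin ?sqrtr_ge0.
Qed.

Lemma bmo_bound_finite_duality (L : R) (s : seq index) : 0 < L ->
  bmo_bound mun mum chn chm gn gm r b L ->
  uniq s -> {in s, forall t, idx t} -> {in s, forall t, coef t != 0} ->
  ((\sum_(t <- s) normc (coef t * b (hu t)))%:E <=
    (144 * L)%:E * \int[mu]_z (sf s z)%:E)%E.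
Proof.
move=> L0 bL us sidx s0.
rewrite (eq_bigr (fun t => normc (coef t) * normc (b (hu t)))); last first.
  by move=> t _; rewrite normcM.
apply: (level_set_duality mu s S) => //.
- by move=> t ts; apply: S_gt0; [exact: sidx|exact: s0].
- move=> t /s0 c0; rewrite lt_def normc_ge0 andbT.
  by apply: contra_neq c0 => h; apply: (@eq0_normc R).
- by move=> t; exact: normc_ge0.
(* The BMO condition is tested on [U] itself, which is admissible as a union of rectangles of the
   second grid; the resulting inequality of square roots is then squared. *)
- move=> P; set U := \bigcup_(i in _) _.
  have mU : measurable U by apply: fin_bigcup_measurable => //; exact: finite_seq.
  have Ufin : (mu U < +oo)%E.
    apply: (@le_lt_trans _ _ (\sum_(t \in [set` [seq t <- s | P t]]) mu (S t))%E).
      by apply: content_sub_fsum => //; exact: finite_seq.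
    by rewrite fsbig_finite//; apply: lte_sum_pinfty => i _; rewrite S_fin.
  have Ucov z : U z -> exists S : cube R n * cube R m,
      [/\ Dn' S.1, Dm' S.2, rect S z & rect S `<=` U].
    move=> [t /=]; rewrite mem_filter => /andP[Pt ts] Sz.
    have [[? _ _] [? _ _]] := good_index_SofP t (sidx _ ts).
    exists (Srect t); split => // z' Sz'.
    by exists t => //=; rewrite mem_filter Pt.
  have bU := bL Dn Dn' Dm Dm' DnP DnP' DmP DmP' U Ufin Ucov.
  have sumU : ((\sum_(t <- s | P t) normc (b (hu t)) ^+ 2)%:E <=
      bmo_sum mun mum chn chm gn gm r Dn Dn' Dm Dm' b U)%E.
    rewrite -big_filter; apply: sum_le_bmo_sum; first exact: filter_uniq.
      by move=> t; rewrite mem_filter => /andP[_ /sidx].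
    by move=> t tP z Sz; exists t.
  have fU : mu U \is a fin_num by rewrite ge0_fin_numE.
  have sum0 : 0 <= \sum_(t <- s | P t) normc (b (hu t)) ^+ 2.
    by apply: sumr_ge0 => t _; exact: sqr_ge0.
  have {bU} : (sqrte (\sum_(t <- s | P t) normc (b (hu t)) ^+ 2)%:E <=
      L%:E * sqrte (mu U))%E.
    by apply: le_trans bU; rewrite lee_sqrt// (le_trans _ sumU)// lee_fin.
  rewrite -(fineK fU) /= -!EFinM !lee_fin => sqrt_le.
  rewrite -(sqr_sqrtr sum0) -[fine (mu U)]sqr_sqrtr ?fine_ge0// -exprMn.
  by rewrite lerXn2r// nnegrE ?sqrtr_ge0// mulr_ge0 ?sqrtr_ge0// ltW.
- move=> P W mW Wle.
  have sP t : t \in [seq i <- s | P i] -> idx t /\ P t.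
    by rewrite mem_filter => /andP[? /sidx].
  have [[wn Dn'E] _] := DnP'; have [[wm Dm'E] _] := DmP'.
  apply: (product_nested_cover_le mun' mum' (fun t => cset (Sof r Dn' t.1.1))
    (fun t => cset (Sof r Dm' t.2.1))) => //.
  - by move=> t; exact: measurable_cset.
  - by move=> t; exact: measurable_cset.
  - by move=> t; exact: cset_fin_n.
  - by move=> t; exact: cset_fin_m.
  - move=> t u /sP[/good_index_SofP[[+ _ _] _] _].
    move=> + /sP[/good_index_SofP[[+ _ _] _] _].
    by rewrite Dn'E; exact: grid_nested.
  - move=> t u /sP[/good_index_SofP[_ [+ _ _]] _].
    move=> + /sP[/good_index_SofP[_ [+ _ _]] _].
    by rewrite Dm'E; exact: grid_nested.
  - move=> t; rewrite mem_filter => /andP[Pt ts].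
    by rewrite -muS; apply: Wle.
Qed.

(** The norm is an infimum, so each finite partial sum is estimated with the constant [N + e'],
    which is positive even if [N] is 0, and the error then tends to 0. *)
Lemma esum_pairing_term_le (N : R) :
  bmo_norm mun mum chn chm gn gm r b = N%:E ->
  (\esum_(t in idx) (normc (pairing_term mun mum chn chm b lambda t))%:E <=
    (144 * N)%:E * L1norm mun mum sqf)%E.
Proof.
move=> NE.
have N0 : 0 <= N.
  rewrite -lee_fin -NE; apply: le_ereal_inf_tmp => _ [L [L0 _] <-].
  by rewrite lee_fin.
apply: esum_le => s us sidx.
(* Terms with zero coefficient contribute nothing, and the finite duality requires positive
   coefficients on sets of positive measure. *)
pose s' := [seq t <- s | coef t != 0].
have us' : uniq s' by exact: filter_uniq.
have s'P t : t \in s' -> idx t /\ coef t != 0.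
  by rewrite mem_filter => /andP[? /sidx].
pose q := fine (\int[mu]_z (sf s' z)%:E)%E.
have sf_ge0 : (0 <= \int[mu]_z (sf s' z)%:E)%E.
  by apply: integral_ge0 => z _; rewrite lee_fin sqrtr_ge0.
have qE : (\int[mu]_z (sf s' z)%:E)%E = q%:E.
  by rewrite fineK// ge0_fin_numE// sf_integral_fin.
have q0 : 0 <= q by exact: fine_ge0.
have qL1 : (q%:E <= L1norm mun mum sqf)%E.
  rewrite -qE /L1norm; apply: (@le_integral_ge0 _ _ _ mu) => z.
    by rewrite lee_fin sqrtr_ge0.
  apply: (le_trans (sf_le_square_fun s' z us' _)); last exact: lee_abs.
  by move=> t /s'P[].
apply: (@le_trans _ _ ((144 * N)%:E * q%:E)%E); last first.
  by rewrite lee_wpmul2l// lee_fin mulr_ge0.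
rewrite (_ : \sum_(t <- s) (normc (pairing_term mun mum chn chm b lambda t))%:E
  = (\sum_(t <- s') normc (coef t * b (hu t)))%:E)%E; last first.
  rewrite -sumEFin big_filter [RHS]big_mkcond; apply: eq_bigr => t _.
  rewrite /pairing_term -/(coef t); case: eqP => //= ->.
  by rewrite mul0r normc0.
rewrite -EFinM lee_fin; apply/ler_addgt0Pr => e e0.
(* Chosen so that the extra term [144 * e' * q] is at most [e]; the added 1 keeps the denominator
   positive when [q] is 0. *)
pose e' := e / (144 * q + 1).
have den0 : 0 < 144 * q + 1 by rewrite ltr_wpDl// mulr_ge0.
have e'0 : 0 < e' by rewrite divr_gt0.
have bN : bmo_bound mun mum chn chm gn gm r b (N + e').
  have : (bmo_norm mun mum chn chm gn gm r b < (N + e')%:E)%E.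
    by rewrite NE lte_fin ltrDl.
  move=> /ereal_inf_lt[_ [L [L0 bL] <-]]; rewrite lte_fin => LN.
  move=> ? ? ? ? g1 g2 g3 g4 Om Om1 Om2.
  apply: (le_trans (bL _ _ _ _ g1 g2 g3 g4 Om Om1 Om2)).
  by rewrite lee_wpmul2r ?sqrte_ge0// lee_fin ltW.
have Ne0 : 0 < N + e' by rewrite ltr_wpDl.
have := bmo_bound_finite_duality (N + e') s' Ne0 bN us' _ _.
rewrite qE -EFinM lee_fin.
move=> /(_ (fun t ts => (s'P t ts).1) (fun t ts => (s'P t ts).2)) /le_trans; apply.
rewrite mulrDr mulrDl lerD2l mulrAC.
rewrite [leLHS](_ : _ = e * (144 * q / (144 * q + 1))); last first.
  by rewrite /e'; field; rewrite gt_eqF.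
by apply: ler_piMr; [exact: ltW|rewrite ler_pdivrMr// mul1r lerDl].
Qed.

End finite_duality.

Theorem proposition7p2 (R : realType) (n m : nat)
    (n_gt0 : (0 < n)%N) (m_gt0 : (0 < m)%N)
    (mun : {measure set (borel R n) -> \bar R})
    (mum : {measure set (borel R m) -> \bar R})
    (lamn : 'rV[R]_n -> R -> R) (lamm : 'rV[R]_m -> R -> R) (Cn Cm : R)
    (mun_ud : upper_doubling mun lamn Cn)
    (mum_ud : upper_doubling mum lamm Cm)
    (alpha beta : R) (alpha_gt0 : 0 < alpha) (beta_gt0 : 0 < beta)
    (r : nat) (r_gt0 : (0 < r)%N)
    (chn : cube R n -> 'I_(2 ^ n) -> cube R n)
    (chm : cube R m -> 'I_(2 ^ m) -> cube R m)
    (chnP : children_indexing mun chn)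
    (chmP : children_indexing mum chm) :
  exists2 C : R, 0 < C &
  forall b : ('rV[R]_n * 'rV[R]_m -> R[i]) -> R[i],
    pairing_linear mun mum chn chm b ->
    (bmo_norm mun mum chn chm (gam alpha Cn) (gam beta Cm) r b < +oo)%E ->
  forall (Dn Dn' : set (cube R n)) (Dm Dm' : set (cube R m)),
    dyadic_grid Dn -> dyadic_grid Dn' -> dyadic_grid Dm -> dyadic_grid Dm' ->
  forall lambda : haar_index -> R[i],
    let idx := good_index (gam alpha Cn) (gam beta Cm) r Dn Dn' Dm Dm' in
    let term := pairing_term mun mum chn chm b lambda in
    let rhs :=
      (C%:E * bmo_norm mun mum chn chm (gam alpha Cn) (gam beta Cm) r b *
       L1norm mun mum (square_fun mun mum chn chm
         (gam alpha Cn) (gam beta Cm) r Dn Dn' Dm Dm' lambda))%E in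
    ((rhs < +oo)%E -> abs_summable idx term) /\
    ((normc (csum idx term))%:E <= rhs)%E.
Proof.
(* Twice the constant 144 of [esum_pairing_term_le], the 2 coming from [normc_csum_le]. *)
exists 288; first by rewrite ltr0n.
move=> b _ bmo_fin Dn Dn' Dm Dm' DnP DnP' DmP DmP' lambda idx term rhs.
set nrm := bmo_norm _ _ _ _ _ _ _ _ in bmo_fin rhs *.
have nrm0 : (0 <= nrm)%E.
  by apply: le_ereal_inf_tmp => _ [L [L0 _] <-]; rewrite lee_fin.
have nrmE : nrm = (fine nrm)%:E by rewrite fineK// ge0_fin_numE.
have le_E := esum_pairing_term_le mun mum lamn lamm Cn Cm mun_ud mum_ud
  chn chm chnP chmP (gam alpha Cn) (gam beta Cm) r Dn Dn' Dm Dm' DnP DnP' DmP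
  DmP' b lambda (fine nrm) nrmE.
rewrite -/idx -/term in le_E.
move: le_E; set E := esum _ _; set Q := L1norm _ _ _ => le_E.
have E0 : (0 <= E)%E by apply: esum_ge0 => t _; rewrite lee_fin normc_ge0.
have le_rhs : (2%:E * E <= rhs)%E.
  rewrite /rhs nrmE -EFinM (_ : 288 * fine nrm = 2 * (144 * fine nrm)); last by ring.
  by rewrite EFinM -muleA lee_wpmul2l.
have sumE : (\esum_(t in idx) `|(normc (term t))%:E| = E)%E.
  by apply: eq_esum => t _; rewrite gee0_abs// lee_fin normc_ge0.
split.
  move=> rhs_fin; rewrite /abs_summable /summable sumE.
  apply: le_lt_trans rhs_fin; apply: le_trans le_rhs.
  by rewrite lee_pemull// lee_fin ler1n.
apply: le_trans le_rhs.
have [Efin|] := ltP E +oo%E; last first.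
  by rewrite leye_eq => /eqP ->; rewrite gt0_muley ?lte_fin ?ltr0n// leey.
have EE : E = (fine E)%:E by rewrite fineK// ge0_fin_numE.
by rewrite EE -EFinM lee_fin; apply: normc_csum_le; rewrite -EE.
Qed.
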